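(* Let $X$ be a topological space, let $M$ be a set of ultrafilters over a set $I$, and let $F=\bigcap_{D\in M}D$. Then the following conditions are equivalent. (1) $X$ is weakly $M$-compact. (2) For every open cover $(O_Z)_{Z\in F}$ of $X$, there is some $i\in I$ such that $(O_Z)_{i\in Z\in F}$ (the subfamily indexed by those $Z\in F$ with $i\in Z$) is a cover of $X$.
   Context: No separation axiom is assumed. If $M$ is a set of ultrafilters over a set $I$, a topological space $X$ is weakly $M$-compact if and only if, for every sequence $(x_i)_{i\in I}$ of elements of $X$, there is $x\in X$ such that, for every neighborhood $U$ of $x$, there is $D\in M$ such that $\{i\in I\mid x_i\in U\}\in D$. *)

(* Defs.v *)
From mathcomp Require Import all_boot all_order all_algebra.
From mathcomp Require Import all_classical all_reals all_analysis.

Set Implicit Arguments.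
Unset Strict Implicit.
Unset Printing Implicit Defensive.

Local Open Scope classical_set_scope.

Definition weakly_compact_wrt (I : Type) (M : set (set_system I))
    (X : topologicalType) : Prop :=
  forall x_ : I -> X, exists x : X, forall U : set X, nbhs x U ->
    exists2 D : set_system I, M D & D [set i | U (x_ i)].

(* The family is given by a total function [O], of which only the values at
   the indices in [F] matter. *)
Definition open_cover (K : Type) (X : topologicalType) (F : set K)
    (O : K -> set X) : Prop :=
  (forall Z, F Z -> open (O Z)) /\ cover F O = [set: X].

(* Main.v *)
Require Import Defs.
From mathcomp Require Import all_boot all_order all_algebra.
From mathcomp Require Import all_classical all_reals all_analysis.

Local Open Scope classical_set_scope.

(** A point [x] fails to be a limit point of the sequence [x_] in the sense of
    [M] when it has a neighborhood [U] such that [[set i | U (x_ i)]] is in no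
    [D] of [M]. As each [D] is an ultrafilter, this says that the set [Z] of
    the indices [i] with [~ U (x_ i)] is in every [D], that is, in [F].
    So the sequence has no limit point exactly when [X] is covered by the open
    sets that it avoids along some [Z] in [F]. The largest open set avoided
    along [Z] is the interior of the complement of [x_ @` Z], and the cover by
    these sets is the extreme one for the second condition: for no [i] does the
    subfamily of the [Z] that contain [i] cover the point [x_ i]
    (lemma [cover_weakly_compact_wrt]).
    Conversely, if an open cover [O] has no covering subfamily of this form,
    choosing for each [i] a point [x_ i] that the [i]-th subfamily misses gives
    a sequence that avoids [O Z] along [Z] for every [Z] in [F], hence has no
    limit point (lemma [weakly_compact_wrt_cover]). *)

Lemma not_cover_exists (T K : Type) (D : set K) (O : K -> set T) :
  cover D O <> [set: T] -> exists x, forall k, D k -> ~ O k x.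
Proof.
move=> ncov; apply: contrapT => /forallNP nex; apply: ncov.
rewrite -subTset => x _; apply: contrapT => nx.
by apply: (nex x) => k Dk Okx; apply: nx; exists k.
Qed.

(** A limit point cannot lie in an open set [V] avoided along [Z] in [F]: the
    indices of the terms in [V] form a set of some [D], which meets [Z]
    because [Z] is also in [D]. *)
Lemma weakly_compact_wrt_cover (X : topologicalType) (I : Type)
    (M : set (set_system I)) (hM : forall D, M D -> ProperFilter D)
    (O : set I -> set X) :
  weakly_compact_wrt M X -> open_cover (\bigcap_(D in M) D) O ->
  exists i : I,
    cover [set Z | (\bigcap_(D in M) D) Z /\ Z i] O = [set: X].
Proof.
move=> wc [openO coverO]; apply: contrapT => /forallNP ncov.
have [x_ avoid] := choice (fun i => not_cover_exists _ _ _ _ (ncov i)).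
have [x xlim] := wc x_.
have [Z FZ OZx] : cover (\bigcap_(D in M) D) O x by rewrite coverO.
have [D MD DU] := xlim _ (open_nbhs_nbhs (conj (openO Z FZ) OZx)).
have PD := hM D MD.
have [i [OZxi Zi]] := filter_ex (filterI DU (FZ D MD)).
exact: avoid OZxi.
Qed.

(** The maximality of the ultrafilters puts the set of the indices outside a
    bad neighborhood in every [D], so that it may serve as an index of the
    cover. *)
Lemma cover_weakly_compact_wrt (X : topologicalType) (I : Type)
    (M : set (set_system I)) (hM : forall D, M D -> UltraFilter D) :
  (forall O : set I -> set X, open_cover (\bigcap_(D in M) D) O ->
     exists i : I,
       cover [set Z | (\bigcap_(D in M) D) Z /\ Z i] O = [set: X]) ->
  weakly_compact_wrt M X.
Proof.
move=> hcover x_; apply: contrapT => /forallNP nolim.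
pose O (Z : set I) : set X := (~` (x_ @` Z))°.
have [|i coveri] := hcover O.
  split=> [Z _|]; first exact: open_interior.
  rewrite -subTset => x _.
  have /existsNP[U /not_implyP[Ux nU]] := nolim x.
  exists [set i | ~ U (x_ i)] => [D MD|].
    have UD := hM D MD.
    have [DU|//] := in_ultra_setVsetC [set i | U (x_ i)] UD.
    by case: nU; exists D.
  by apply: filterS Ux => y Uy [i nUxi xiy]; apply: nUxi; rewrite xiy.
have [Z [_ Zi] OZxi] : cover [set Z | (\bigcap_(D in M) D) Z /\ Z i] O (x_ i).
  by rewrite coveri.
by apply: (interior_subset OZxi); exists i.
Qed.

Theorem corollary3p14 (X : topologicalType) (I : Type)
    (M : set (set_system I)) (hM : forall D, M D -> UltraFilter D) :
  let F : set (set I) := \bigcap_(D in M) D in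
  weakly_compact_wrt M X <->
  (forall O : set I -> set X, open_cover F O ->
     exists i : I, cover [set Z | F Z /\ Z i] O = [set: X]).
Proof.
split=> [wc O|]; last exact: cover_weakly_compact_wrt.
by apply: weakly_compact_wrt_cover wc => D /hM [].
Qed.
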